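(* Let $\mathfrak{A}$ be a residuated lattice and let $F$ be a filter of $\mathfrak{A}$. Then $Min_F(\mathfrak{A})$, with the hull-kernel topology $\tau_h$, is a Hausdorff space.
   Context: A residuated lattice is an algebra $\mathfrak{A}=(A;\vee,\wedge,\odot,\rightarrow,0,1)$ such that $(A;\vee,\wedge,0,1)$ is a bounded lattice, $(A;\odot,1)$ is a commutative monoid, and $(\odot,\rightarrow)$ is an adjoint pair, i.e. $x\odot y\le z$ iff $x\le y\rightarrow z$. A filter of $\mathfrak{A}$ is a non-empty subset $F\subseteq A$ such that $x,y\in F$ implies $x\odot y\in F$, and $x\in F$, $y\in A$ imply $x\vee y\in F$. A filter is proper if it is not equal to $A$. A proper filter $P$ is prime if for all filters $F_1,F_2$, $F_1\cap F_2=P$ implies $F_1=P$ or $F_2=P$. $Min_F(\mathfrak{A})$ is the set of $F$-minimal prime filters, i.e. the minimal elements (under inclusion) of the set of prime filters containing $F$. For a collection $\Pi$ of prime filters, the hull-kernel topology $\tau_h$ on $\Pi$ is the topology whose closed sets are the sets $h_\Pi(X)=\{P\in\Pi\mid X\subseteq P\}$, $X\subseteq A$. *)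

(* Defs.v *)
From HB Require Import structures.
From mathcomp Require Import all_boot all_order.
From mathcomp Require Import boolp classical_sets topology.

Set Implicit Arguments.
Unset Strict Implicit.
Unset Printing Implicit Defensive.

Import Order.TTheory.
Local Open Scope classical_set_scope.

(* The bounds 0 and 1 are the lattice's [\bot] and [\top], with
   [\bot = \top] allowed; the last axiom is the adjunction. *)
HB.mixin Record isResiduated (d : Order.disp_t) A of Order.TBLattice d A := {
  rmul : A -> A -> A ;
  rimp : A -> A -> A ;
  rmulA : associative rmul ;
  rmulC : commutative rmul ;
  rmul1x : left_id (\top%O : A) rmul ;
  rmul_le_imp : forall x y z : A,
    (rmul x y <= z)%O = (x <= rimp y z)%O
}.

#[short(type="residuatedLatticeType")]
HB.structure Definition ResiduatedLattice (d : Order.disp_t) :=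
  { A of isResiduated d A & Order.TBLattice d A }.

Section Filters.
Context {d : Order.disp_t} {A : residuatedLatticeType d}.
Implicit Types (F P Q X : set A) (Pi : set (set A)).

(* Named to avoid confusion with the topological [Filter]. *)
Definition lattice_filter F : Prop :=
  [/\ F !=set0,
      forall x y, F x -> F y -> F (rmul x y) &
      forall x y, F x -> F (x `|` y)%O].

Definition proper_lattice_filter F : Prop := lattice_filter F /\ F <> setT.

Definition prime_lattice_filter P : Prop :=
  proper_lattice_filter P /\
  forall F1 F2, lattice_filter F1 -> lattice_filter F2 ->
    F1 `&` F2 = P -> F1 = P \/ F2 = P.

Definition primes_above F : set (set A) :=
  [set P | prime_lattice_filter P /\ F `<=` P].

Definition min_primes F : set (set A) :=
  [set P | primes_above F P /\
           forall Q, primes_above F Q -> Q `<=` P -> Q = P].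

Lemma min_primes_prime F : min_primes F `<=` prime_lattice_filter.
Proof. by move=> P [[]]. Qed.

Lemma rmul_joinr (u x y : A) :
  (rmul u (x `|` y) = rmul u x `|` rmul u y)%O.
Proof.
have mono (v w : A) : (v <= w)%O -> (rmul u v <= rmul u w)%O.
  move=> vw; rewrite rmulC rmul_le_imp; apply: le_trans vw _.
  by rewrite -rmul_le_imp rmulC.
apply/le_anti/andP; split; last by rewrite leUx !mono ?leUl ?leUr.
by rewrite rmulC rmul_le_imp leUx -!rmul_le_imp ![rmul _ u]rmulC leUl leUr.
Qed.

Lemma rmul_lel (x y : A) : (rmul x y <= x)%O.
Proof.
rewrite rmulC rmul_le_imp; apply: le_trans (lex1 y) _.
by rewrite -rmul_le_imp rmul1x.
Qed.

Lemma lattice_filter_le F (x y : A) :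
  lattice_filter F -> (x <= y)%O -> F x -> F y.
Proof. by move=> [_ _ FU] xy Fx; rewrite -(join_r xy); exact: FU. Qed.

Lemma lattice_filter_colon F (y : A) :
  lattice_filter F -> lattice_filter [set z | F (y `|` z)%O].
Proof.
move=> FF; have [[e Fe] FM FU] := FF; split.
- by exists e => /=; rewrite joinC; exact: FU.
- move=> a b /= Fa Fb; apply: lattice_filter_le FF _ (FM _ _ Fa Fb).
  rewrite rmul_joinr leUx; apply/andP; split.
    by rewrite rmulC (le_trans (rmul_lel _ _)) ?leUl.
  rewrite rmulC rmul_joinr leUx.
  rewrite [rmul b y]rmulC (le_trans (rmul_lel _ _)) ?leUl //=.
  by rewrite rmulC leUr.
- by move=> a b /= Fa; rewrite joinA; exact: FU.
Qed.

Lemma prime_lattice_filter_join P (x y : A) :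
  prime_lattice_filter P -> P (x `|` y)%O -> P x \/ P y.
Proof.
move=> [[PF _] Pirr] Pxy; have [[e Pe] _ PU] := PF.
pose F1 := [set z | P (y `|` z)%O].
pose F2 := [set z | forall w, F1 w -> P (w `|` z)%O].
have F1F : lattice_filter F1 by exact: lattice_filter_colon.
have F2F : lattice_filter F2.
  split.
  - by exists e => w _; rewrite joinC; exact: PU.
  - move=> a b Fa Fb w F1w; have [_ PM _] := lattice_filter_colon w PF.
    by apply: PM; [exact: Fa|exact: Fb].
  - by move=> a b Fa w F1w; rewrite joinA; apply: PU; exact: Fa.
have F12 : F1 `&` F2 = P.
  apply/seteqP; split=> [z [F1z F2z]|z Pz].
    by have := F2z _ F1z; rewrite joinxx.
  split=> [|w _]; rewrite /F1 /= joinC; exact: PU.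
case: (Pirr _ _ F1F F2F F12) => <-; [left|right].
  by rewrite /F1 /= joinC.
by move=> w; rewrite /F1 /= joinC.
Qed.

Definition hull Pi X : set Pi := [set P : Pi | X `<=` val P].

(* The hulls are the closed sets of a topology only because the members of
   [Pi] are prime, so the carrier depends on a proof of that. *)
Definition hull_kernel Pi (primePi : Pi `<=` prime_lattice_filter) : Type := Pi.

Section HullKernel.
Variables (Pi : set (set A)) (primePi : Pi `<=` prime_lattice_filter).

Definition hk_open : set (set (hull_kernel primePi)) :=
  [set U | exists X : set A, ~` U = hull X].

Lemma hk_openT : hk_open setT.
Proof.
exists setT; rewrite setCT; apply/seteqP; split=> // P /= TP.
have [[_ PT] _] := primePi (set_mem (valP P)).
by apply: PT; apply/seteqP.
Qed.

Lemma hk_openI : setI_closed hk_open.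
Proof.
move=> U V [X UX] [Y VY].
exists [set z | exists x y, [/\ X x, Y y & z = (x `|` y)%O]].
rewrite setCI UX VY; apply/seteqP; split=> P.
  have [[[_ _ PU] _] _] := primePi (set_mem (valP P)).
  case=> /= PXY _ [x [y [Xx Yy ->]]]; first exact/PU/PXY.
  by rewrite joinC; exact/PU/PXY.
move=> /= PXY; apply: contrapT => /not_orP[/existsNP[x /not_implyP[Xx Px]]].
move=> /existsNP[y /not_implyP[Yy Py]].
have Pxy : val P (x `|` y)%O by apply: PXY; exists x, y.
by case: (prime_lattice_filter_join (primePi (set_mem (valP P))) Pxy).
Qed.

Lemma hk_open_bigU (I : Type) (f : I -> set (hull_kernel primePi)) :
  (forall i, hk_open (f i)) -> hk_open (\bigcup_i f i).
Proof.
move=> /choice[X fX]; exists (\bigcup_i X i).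
rewrite setC_bigcup; apply/seteqP; split=> P /=.
  move=> fP x [i _ Xx]; have := fP i Logic.I.
  by rewrite fX; exact.
by move=> XP i _; rewrite fX => x Xx; apply: XP; exists i.
Qed.

HB.instance Definition _ := Choice.copy (hull_kernel primePi) Pi.
HB.instance Definition _ := isOpenTopological.Build (hull_kernel primePi)
  hk_openT hk_openI hk_open_bigU.

Lemma hull_kernel_closedP (C : set (hull_kernel primePi)) :
  closed C <-> exists X : set A, C = hull X.
Proof.
by rewrite -openC -[X in _ <-> exists _, X = _]setCK.
Qed.

End HullKernel.
End Filters.

(* Main.v *)
Require Import Defs.
From mathcomp Require Import all_boot all_order.
From mathcomp Require Import boolp classical_sets topology.

(** Every element x of an F-minimal prime P has a partner y outside P with
    x `|` y in F: otherwise the join-closed set {x `|` y | y notin P} avoids F,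
    and a filter above F maximal among those avoiding it is a prime strictly
    below P. If Q is another F-minimal prime and x is in P but not in Q, then
    "x notin R" and "y notin R" define disjoint open neighbourhoods of Q and P. *)

Set Implicit Arguments.
Unset Strict Implicit.
Unset Printing Implicit Defensive.

Import Order.TTheory.
Local Open Scope classical_set_scope.

Section MinimalPrimes.
Context {d : Order.disp_t} {A : residuatedLatticeType d}.
Implicit Types (F P Q S : set A) (C : set (set A)).

(** Elements from two members of the chain both lie in the larger one, whose union with [F] is
    already a filter. *)
Lemma lattice_filterU_bigcup F C : lattice_filter F ->
  (forall X, C X -> lattice_filter (F `|` X)) -> total_on C subset ->
  lattice_filter (F `|` \bigcup_(X in C) X).
Proof.
move=> [[e Fe] FM FU] CF Ctot.
have sub X : C X -> F `|` X `<=` F `|` \bigcup_(X in C) X.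
  by move=> CX z [Fz|Xz]; [left|right; exists X].
split; first by exists e; left.
- move=> x y [Fx|[X CX Xx]] [Fy|[Y CY Yy]].
  + by left; exact: FM.
  + by apply: (sub _ CY); have [_ M _] := CF _ CY; apply: M; [left|right].
  + by apply: (sub _ CX); have [_ M _] := CF _ CX; apply: M; [right|left].
  + have [XY|YX] := Ctot _ _ CX CY.
      apply: (sub _ CY); have [_ M _] := CF _ CY.
      by apply: M; right => //; exact: XY.
    apply: (sub _ CX); have [_ M _] := CF _ CX.
    by apply: M; right => //; exact: YX.
- move=> x y [Fx|[X CX Xx]]; first by left; exact: FU.
  by apply: (sub _ CX); have [_ _ U] := CF _ CX; apply: U; right.
Qed.

(** Take [Q] maximal among the filters above [F] avoiding [S]. If [Q] were the intersection of two
    strictly larger filters, each would meet [S], and the join of the two witnesses would lie in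
    both [Q] and [S]. *)
Lemma prime_lattice_filter_avoiding F S : lattice_filter F -> S !=set0 ->
  (forall s t, S s -> S t -> S (s `|` t)%O) -> (forall s, S s -> ~ F s) ->
  exists2 Q, primes_above F Q & forall s, S s -> ~ Q s.
Proof.
move=> FF [s0 Ss0] SU SF.
(* Joining with [F] makes the empty set admissible, as the union of the
   empty chain. *)
pose good X := lattice_filter (F `|` X) /\ forall s, S s -> ~ (F `|` X) s.
have [X [[QF QS] Xmax]] : exists X, good X /\ forall B, X `<` B -> ~ good B.
  apply: Zorn_bigcup => C Cgood Ctot; split.
    by apply: lattice_filterU_bigcup => // X /Cgood[].
  move=> s Ss [/(SF _ Ss)//|[X CX Xs]].
  by have [_ /(_ _ Ss)] := Cgood _ CX; apply; right.
(* Maximality concerns [X], but a filter [G] above [F] absorbs [F], so [G] itself competes with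
   [X]. *)
have meetsS G : lattice_filter G -> F `|` X `<=` G -> F `|` X <> G ->
    exists2 s, S s & G s.
  move=> GF QG QneG; apply: contrapT => GS.
  have FG : F `|` G = G by apply/setUidPr => z Fz; apply: QG; left.
  apply: (Xmax G); first split.
  - by move=> z Xz; apply: QG; right.
  - by move=> GX; apply: QneG; apply/seteqP; split=> // z /GX; right.
  - by split; rewrite FG // => s Ss Gs; apply: GS; exists s.
exists (F `|` X) => //; split; last by move=> z; left.
split; first by split=> // QT; apply: (QS _ Ss0); rewrite QT.
move=> F1 F2 F1F F2F F12; apply: contrapT => /not_orP[F1Q F2Q].
have [||s Ss F1s] := meetsS _ F1F; [by rewrite -F12 => z []|exact/nesym|].
have [||t St F2t] := meetsS _ F2F; [by rewrite -F12 => z []|exact/nesym|].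
apply: (QS _ (SU _ _ Ss St)); rewrite -F12; split.
  by have [_ _] := F1F; apply.
by rewrite joinC; have [_ _] := F2F; apply.
Qed.

Lemma min_primes_join_mem F P (x : A) : lattice_filter F -> min_primes F P ->
  P x -> exists2 y, ~ P y & F (x `|` y)%O.
Proof.
move=> FF [[Pprime FP] Pmin] Px; apply: contrapT => noy.
have [[_ PT] _] := Pprime.
have [y0 Py0] : exists y, ~ P y.
  by apply/existsNP => allP; apply: PT; apply/seteqP; split=> // z _.
pose S := [set (x `|` y)%O | y in ~` P].
have [|||Q Qprime QS] := @prime_lattice_filter_avoiding F S FF.
- by exists (x `|` y0)%O, y0.
(* Primality of [P] keeps the join of [y] and [z] outside [P]. *)
- move=> _ _ [y Py <-] [z Pz <-]; exists (y `|` z)%O.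
    by move=> /(prime_lattice_filter_join Pprime)[].
  by rewrite joinACA joinxx.
- by move=> _ [y Py <-] Fxy; apply: noy; exists y.
have [[[[_ _ QU] _] _] _] := Qprime.
(* A [y] in [Q] but not in [P] would put its join with [x] in both [Q] and [S]. *)
have QP : Q `<=` P.
  move=> y Qy; apply: contrapT => Py.
  by apply: (QS (x `|` y)%O); [exists y|rewrite joinC; exact: QU].
have Qx : Q x by rewrite (Pmin _ Qprime QP).
by apply: (QS (x `|` y0)%O); [exists y0|exact: QU].
Qed.

Lemma open_hull_kernel_notin (Pi : set (set A))
    (primePi : Pi `<=` prime_lattice_filter) (x : A) :
  open [set R : hull_kernel primePi | ~ val R x].
Proof.
rewrite -closedC; apply/hull_kernel_closedP; exists [set x].
apply/seteqP; split=> R /=; first by move=> /contrapT Rx _ ->.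
by move=> xR; apply; exact: xR.
Qed.

End MinimalPrimes.

Theorem proposition4p1 (d : Order.disp_t) (A : residuatedLatticeType d)
    (F : set A) (filterF : lattice_filter F) :
  hausdorff_space (hull_kernel (@min_primes_prime d A F)).
Proof.
rewrite open_hausdorff => P Q PneQ.
have minP := set_mem (valP P); have minQ := set_mem (valP Q).
(* Otherwise [P] lies inside [Q], and minimality of [Q] makes them equal. *)
have [x Px Qx] : exists2 x, val P x & ~ val Q x.
  apply: contrapT => nox; move/eqP: PneQ; apply; apply: val_inj.
  apply: (minQ.2 _ minP.1) => x Px.
  by apply: contrapT => Qx; apply: nox; exists x.
have [y Py Fxy] := min_primes_join_mem filterF minP Px.
exists ([set R | ~ val R y], [set R | ~ val R x]) => /=.
  by split; exact/mem_set.
split; [exact: open_hull_kernel_notin|exact: open_hull_kernel_notin|].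
(* A common point [R] contains [F], hence the join of [x] and [y], hence one of them by
   primality. *)
apply/eqP/seteqP; split=> // R [/= Ry Rx].
have [[Rprime FR] _] := set_mem (valP R).
by have [] := prime_lattice_filter_join Rprime (FR _ Fxy).
Qed.
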